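(* Let $X$ and $Y$ be non-negative continuous random variables and let $\eta>0$. If $X\leq_{HQ}Y$ or $X\geq_{RHQ}Y$, then $X\leq_{QFGCPE}Y$, i.e. $\mathcal{C}\mathcal{P}\xi_Q^\eta(X)\le \mathcal{C}\mathcal{P}\xi_Q^\eta(Y)$.
   Context: Random variables are non-negative and absolutely continuous. For a random variable $X$ with distribution function $G_X$ and density $g_X$, the quantile function is $Q_X(v)=\inf\{x: G_X(x)\ge v\}$, $0\le v\le 1$, and the quantile density function is $q_X(v)=\frac{d}{dv}Q_X(v)$; it satisfies $q_X(v)\,g_X(Q_X(v))=1$. For $\eta>0$ the quantile-based fractional generalized cumulative past entropy (QFGCPE) of $X$ is $$\mathcal{C}\mathcal{P}\xi_Q^\eta(X)=\frac{1}{\Gamma(\eta+1)}\int_0^1 p(-\ln p)^\eta q_X(p)\,dp$$ (integral assumed finite). The hazard quantile function is $H_X(v)=\frac{g_X(Q_X(v))}{1-v}=[(1-v)q_X(v)]^{-1}$ and the reversed hazard quantile function is $R_X(v)=\frac{g_X(Q_X(v))}{v}=[v\,q_X(v)]^{-1}$, for $v\in(0,1)$. Orders: $X\leq_{HQ}Y$ means $H_X(v)\ge H_Y(v)$ for all $v\in(0,1)$; $X\leq_{RHQ}Y$ means $R_X(v)\le R_Y(v)$ for all $v\in(0,1)$, and $X\geq_{RHQ}Y$ means $Y\leq_{RHQ}X$; $X\leq_{QFGCPE}Y$ means $\mathcal{C}\mathcal{P}\xi_Q^\eta(X)\le \mathcal{C}\mathcal{P}\xi_Q^\eta(Y)$.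 *)

(* Defs.v *)
From HB Require Import structures.
From mathcomp Require Import all_boot all_order all_algebra.
From mathcomp Require Import all_classical all_reals all_analysis.
Set Implicit Arguments.
Unset Strict Implicit.
Unset Printing Implicit Defensive.
Import Order.TTheory GRing.Theory Num.Theory.
Import numFieldNormedType.Exports.
Local Open Scope classical_set_scope.
Local Open Scope ring_scope.

Definition Gamma (R : realType) (a : R) : R :=
  Rintegral lebesgue_measure `]0, +oo[ (fun t : R => t `^ (a - 1) * expR (- t)).

Section quantile_notions.
Context (d : measure_display) (T : measurableType d) (R : realType).
Context (P : probability T R).
Implicit Types (X : {RV P >-> R}) (g : R -> R).

Definition nonnegative_rv X : Prop := {ae P, forall t, 0 <= X t}.

(* g is a version of the density of X with respect to Lebesgue measure; the
   existence of some g is the absolute continuity of X. *)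
Definition is_density X g : Prop :=
  [/\ measurable_fun setT g,
      (forall x, 0 <= g x) &
      (forall A : set R, measurable A ->
        distribution P X A = \int[lebesgue_measure]_(x in A) (g x)%:E)%E].

(* Only the values on ]0, 1[ are meaningful: at v = 0, and possibly at v = 1,
   the set below has no real infimum, and inf returns 0. *)
Definition quantile X (v : R) : R := inf [set x : R | (v%:E <= cdf X x)%E].

(* When X has a density g, the quantile function is differentiable at almost
   every v of ]0, 1[, with quantile_density X v * g (quantile X v) = 1; the
   value of derive1 elsewhere does not matter in the integral below. *)
Definition quantile_density X : R -> R := derive1 (quantile X).

Definition qfgcpe_integrand (eta : R) X (p : R) : R :=
  p * (- ln p) `^ eta * quantile_density X p.

Definition qfgcpe_finite (eta : R) X : Prop :=
  lebesgue_measure.-integrable `]0, 1[ (EFin \o qfgcpe_integrand eta X).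

Definition qfgcpe (eta : R) X : R :=
  (Gamma (eta + 1))^-1 *
  Rintegral lebesgue_measure `]0, 1[ (qfgcpe_integrand eta X).

Definition hazard_quantile X g (v : R) : R := g (quantile X v) / (1 - v).

Definition rev_hazard_quantile X g (v : R) : R := g (quantile X v) / v.

End quantile_notions.

Section quantile_orders.
Context (dX dY : measure_display).
Context (TX : measurableType dX) (TY : measurableType dY) (R : realType).
Context (PX : probability TX R) (PY : probability TY R).
Context (X : {RV PX >-> R}) (Y : {RV PY >-> R}).

Definition hq_le (gX gY : R -> R) : Prop :=
  forall v : R, 0 < v < 1 -> hazard_quantile Y gY v <= hazard_quantile X gX v.

Definition rhq_le (gX gY : R -> R) : Prop :=
  forall v : R, 0 < v < 1 ->
    rev_hazard_quantile X gX v <= rev_hazard_quantile Y gY v.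

Definition qfgcpe_le (eta : R) : Prop := qfgcpe eta X <= qfgcpe eta Y.

End quantile_orders.

(* Main.v *)
Require Import Defs.
From HB Require Import structures.
From mathcomp Require Import all_boot all_order all_algebra.
From mathcomp Require Import all_classical all_reals all_analysis.
From mathcomp Require Import measurable_realfun.
Set Implicit Arguments.
Unset Strict Implicit.
Unset Printing Implicit Defensive.
Import Order.TTheory GRing.Theory Num.Theory.
Import numFieldNormedType.Exports.
Local Open Scope classical_set_scope.
Local Open Scope ring_scope.

(** Both orders say the same thing about the densities: after cancelling the
    common factor [1 - v] or [v], they read [gY (QY v) <= gX (QX v)] on
    ]0, 1[. Since [Q' = 1 / g (Q v)], this is [QX' <= QY'], and the
    entropies are integrals of [Q'] against the nonnegative weight
    [p * (- ln p) `^ eta], with the same nonnegative prefactor.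

    The work lies in the identity [Q' v = 1 / g (Q v)], which holds only for
    almost every [v] because [g] is merely measurable. By Lebesgue
    differentiation the distribution function [F] has derivative [g] outside a
    null set [M]. As [Q] pushes the Lebesgue measure of ]0, 1[ forward to the
    law of the variable ([quantile_transform]), the [v] with [Q v] in [M] form
    a set of measure [P (X in M)], which is zero by absolute continuity;
    likewise for the zero set of [g]. At every other [v], [F] has a positive
    derivative at [Q v]; since [F (Q w) = w] on ]0, 1[ ([real_cdf_quantile],
    by absence of atoms), [Q] inherits the reciprocal derivative
    ([is_derive_right_inverse]). *)

(** * Differentiating a right inverse of a monotone function *)

(** Here [F] may have flat pieces and [Q] may jump, so [F] is not locally
    injective and the inverse function rule, which assumes continuity and
    two-sided cancellation near the point, does not apply. The positive
    derivative of [F] at [Q v] is what makes [Q] continuous at [v]: it gives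
    [F (Q v - t) < v < F (Q v + t)], and monotonicity then traps [Q w] in
    between when [w] is close to [v]. *)
Lemma is_derive_right_inverse (R : realType) (F Q : R -> R) (v a : R) :
  {homo F : x y / x <= y} -> (\forall w \near v, F (Q w) = w) ->
  is_derive (Q v) 1 F a -> 0 < a -> is_derive v 1 Q a^-1.
Proof.
move=> ndF FQ /is_derive1_caratheodory[s [sE sc sQ]] a0.
have FQv : F (Q v) = v by exact: nbhs_singleton FQ.
have s0 : 0 < s (Q v) by rewrite sQ.
have cQ : {for v, continuous Q}.
  have [e /= e0 se] : \forall x \near Q v, 0 < s x by exact: cvgr_gt sc _ s0.
  apply/cvgrPdist_le => /= r r0.
  pose t := Num.min r (e / 2).
  have t0 : 0 < t by rewrite lt_min r0/= divr_gt0.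
  have te : t < e by rewrite gt_min [e / 2 < e]gtr_pMr// invf_lt1 ?ltr1n ?orbT.
  have Fl : F (Q v - t) < v.
    have := sE (Q v - t); rewrite FQv addrAC subrr add0r => FE.
    rewrite -subr_lt0 FE pmulr_rlt0 ?oppr_lt0//; apply: se => /=.
    by rewrite opprB addrC subrK gtr0_norm.
  have Fr : v < F (Q v + t).
    have := sE (Q v + t); rewrite FQv addrAC subrr add0r => FE.
    rewrite -subr_gt0 FE pmulr_lgt0//; apply: se => /=.
    by rewrite opprD addrA subrr add0r normrN gtr0_norm.
  near=> w.
  have FQw : F (Q w) = w by near: w.
  have wl : F (Q v - t) < w by near: w; exact: lt_nbhsr.
  have wr : w < F (Q v + t) by near: w; exact: lt_nbhsl.
  rewrite (@le_trans _ _ t) ?ge_min ?lexx// distrC ler_distl; apply/andP; split.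
    by rewrite leNgt; apply/negP => /ltW/ndF; rewrite FQw leNgt wl.
  by rewrite leNgt; apply/negP => /ltW/ndF; rewrite FQw leNgt wr.
have sQc : {for v, continuous (fun w => (s (Q w))^-1)}.
  by apply: continuousV; [rewrite gt_eqF|exact: continuous_comp].
apply/is_derive1_caratheodory.
(* The slopes of Q at v are the inverses of those of F at Q v: close to v, this
   function is w |-> (s (Q w))^-1. *)
exists (fun w => if w == v then a^-1 else (Q w - Q v) / (w - v)).
split=> [w||]; last by rewrite eqxx.
  by case: eqP => [->|/eqP wv]; rewrite ?subrr ?mulr0// divfK// subr_eq0.
rewrite /prop_for /continuous_at eqxx -{2}sQ.
apply: cvg_trans sQc; apply: near_eq_cvg.
near=> w; case: eqP => [->|/eqP wv]; first by rewrite sQ.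
have FQw : F (Q w) = w by near: w.
have := sE (Q w); rewrite FQw FQv => wE.
have sQw : s (Q w) != 0.
  by apply: contra_neq wv => s00; apply/eqP; rewrite -subr_eq0 wE s00 mul0r.
have QwE : Q w - Q v != 0.
  by apply: contra_neq wv => s00; apply/eqP; rewrite -subr_eq0 wE s00 mulr0.
by rewrite wE invfM mulrCA divff// mulr1.
Unshelve. all: end_near. Qed.

(** * Quantile function and law *)

Section quantile_theory.
Context d (T : measurableType d) (R : realType) (P : probability T R).
Context (X : {RV P >-> R}).
Local Notation mu := (@lebesgue_measure R).

(** The distribution function, as a function into the reals, where derivatives
    make sense. *)
Definition real_cdf (x : R) : R := fine (cdf X x).

Lemma real_cdfE x : (real_cdf x)%:E = cdf X x.
Proof. by rewrite fineK// fin_num_measure. Qed.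

Lemma real_cdf_nondecreasing : {homo real_cdf : x y / x <= y}.
Proof. by move=> x y xy; rewrite -lee_fin !real_cdfE cdf_nondecreasing. Qed.

Lemma real_cdf_itv x : 0 <= real_cdf x <= 1.
Proof. by rewrite -!lee_fin !real_cdfE cdf_ge0 cdf_le1. Qed.

(** The Galois connection between quantile and distribution function. It
    amounts to the infimum being attained, which is right continuity; the
    limits of the distribution function at both infinities make the infimum a
    genuine one for [v] in ]0, 1[. *)
Lemma quantile_le v x : 0 < v < 1 -> (quantile X v <= x) = (v <= real_cdf x).
Proof.
move=> /andP[v0 v1]; rewrite /quantile.
under [X in inf X]eq_set do rewrite -real_cdfE lee_fin.
set S := [set _ | _].
have Sup y z : S y -> y <= z -> S z.
  by move=> /= Sy yz; apply: le_trans Sy _; exact: real_cdf_nondecreasing.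
have Sn0 : S !=set0.
  have /cvgr_gt/(_ _ v1)[M [_ MP]] : real_cdf x @[x --> +oo] --> (1 : R).
    exact/fine_cvg/cvg_cdfy1.
  by exists (M + 1); apply/ltW/MP; rewrite ltrDl.
have Slb : has_lbound S.
  have /cvgr_lt/(_ _ v0)[M [_ MP]] : real_cdf x @[x --> -oo] --> (0 : R).
    exact/fine_cvg/cvg_cdfNy0.
  exists M => y /= Sy; rewrite leNgt; apply/negP => yM.
  by have := MP _ yM; rewrite ltNge Sy.
have Si : v <= real_cdf (inf S).
  rewrite leNgt; apply/negP => Fi.
  have Fc : real_cdf x @[x --> (inf S)^'+] --> real_cdf (inf S).
    by apply: fine_cvg; rewrite real_cdfE; exact: cdf_right_continuous.
  have /cvgr_lt/(_ _ Fi)[e /= e0 eP] := Fc.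
  have [y Sy yS] := inf_adherent e0 (conj Sn0 Slb).
  have iy : inf S <= y by exact: ge_inf.
  have : real_cdf y < v.
    have [yE|ny] := eqVneq y (inf S); first by rewrite yE.
    apply: eP; last by rewrite lt_neqAle eq_sym ny.
    by rewrite /= distrC ger0_norm ?subr_ge0// ltrBlDl.
  by rewrite ltNge Sy.
apply/idP/idP => [|Sx]; first exact: Sup.
exact: ge_inf.
Qed.

Lemma quantile_gt v x : 0 < v < 1 -> (x < quantile X v) = (real_cdf x < v).
Proof. by move=> v01; rewrite ltNge quantile_le// ltNge. Qed.

Lemma quantile_preimage_gt x :
  `]0, 1[ `&` quantile X @^-1` `]x, +oo[ = `]real_cdf x, 1[%classic.
Proof.
have /andP[F0 F1] := real_cdf_itv x.
apply/seteqP; split=> v /=; rewrite !in_itv/= ?andbT.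
  by move=> [v01]; rewrite quantile_gt// => ->; case/andP: v01.
move=> /andP[Fv v1]; have v01 : 0 < v < 1 by rewrite v1 (le_lt_trans F0).
by rewrite quantile_gt.
Qed.

Lemma measurable_quantile : measurable_fun (`]0, 1[ : set R) (quantile X).
Proof.
move=> mD; apply: (measurability _ (RGenOInfty.measurableE R)) => //.
by move=> _ [_ [x ->] <-]; rewrite quantile_preimage_gt.
Qed.

(** Inverse transform sampling: the quantile of a uniform variable has the law
    of [X]. The two measures agree on the half-lines ]x, +oo[ by the Galois
    connection, and these form a pi-system generating the Borel sets. *)
Lemma quantile_transform A : measurable A ->
  mu (`]0, 1[ `&` quantile X @^-1` A) = distribution P X A.
Proof.
have mI : measurable (`]0, 1[ : set R) by [].
have mQ :
    measurable_fun [set: measurableTypeR R] (quantile X \_ `]0, 1[).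
  by apply/(measurable_restrictT _ _).1 => //; exact: measurable_quantile.
(* Q is patched by 0 off ]0, 1[ to be measurable on the whole line. *)
pose m : {measure set R -> \bar R} :=
  pushforward (mrestr mu mI) (quantile X \_ `]0, 1[ : measurableTypeR R -> R).
have mE B : m mQ B = mu (`]0, 1[ `&` quantile X @^-1` B).
  rewrite /m/= /pushforward /mrestr; congr (mu _).
  apply/seteqP; split=> v /= [] + + => [Bv v01|v01 Bv]; split=> //;
    by move: Bv; rewrite patchE mem_set.
move=> mA; rewrite -mE; apply/esym.
apply: (measure_unique (@RGenOInfty.G R)
  (fun n => `]- n%:R, +oo[%classic)) => //.
- exact: RGenOInfty.measurableE.
- move=> _ _ [x ->] [y ->]; exists (Num.max x y).
  apply/predeqP => z /=; rewrite !in_itv/= !andbT gt_max.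
  by split=> [[-> ->]|/andP].
- by move=> n; exists (- n%:R).
- apply/seteqP; split=> // x _; exists (Num.truncn `|x|).+1 => //=.
  rewrite in_itv/= andbT ltrNl; apply: le_lt_trans (truncnS_gt _).
  by rewrite -normrN ler_norm.
- move=> _ [x ->]; rewrite mE quantile_preimage_gt.
  have /andP[_ F1] := real_cdf_itv x.
  rewrite -[LHS]/(ccdf X x) ccdf_1_cdf -real_cdfE.
  rewrite lebesgue_measure_itv/= lte_fin.
  by case: ltP => // F1'; rewrite (@le_anti _ _ (real_cdf x) 1) ?F1// subee.
- by move=> n; rewrite (le_lt_trans (probability_le1 _ _))// ltry.
Qed.

(** * Quantile density of an absolutely continuous law *)

Section with_density.
Context (g : R -> R) (Xg : is_density X g).

(** If [F] jumped over [v] at [q = Q v], then [Q] would be constant equal to [q]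
    on ]v, F q[; by the inverse transform [q] would be an atom of the law, and
    a law with a density has none. *)
Lemma real_cdf_quantile v : 0 < v < 1 -> real_cdf (quantile X v) = v.
Proof.
move=> v01; set q := quantile X v.
have [_ _ dist] := Xg; have /andP[_ Fq1] := real_cdf_itv q.
apply/eqP; rewrite eq_le -(quantile_le q v01) lexx andbT leNgt; apply/negP => vF.
pose B := `]0, 1[ `&` quantile X @^-1` [set q].
have sub : `]v, real_cdf q[ `<=` B.
  move=> w /=; rewrite in_itv/= => /andP[vw wF].
  have w01 : 0 < w < 1.
    by rewrite (lt_trans _ vw) ?(lt_le_trans wF)//; case/andP: v01.
  split; first by rewrite /= in_itv.
  apply/eqP; rewrite eq_le quantile_le// (ltW wF)/= quantile_le//.
  by rewrite (le_trans (ltW vw))// -quantile_le.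
have : (mu `]v, real_cdf q[ <= mu B)%E.
  by rewrite le_measure ?inE//; exact: measurable_quantile.
rewrite /B quantile_transform// dist// integral_set1.
rewrite lebesgue_measure_itv/= lte_fin.
by rewrite vF -EFinB lee_fin subr_le0 leNgt vF.
Qed.

Lemma ae_is_derive_real_cdf :
  {ae mu, forall x : R, is_derive x 1 real_cdf (g x)}.
Proof.
have [mg g0 dist] := Xg.
have ig : mu.-integrable setT (EFin \o g).
  apply/integrableP; split; first exact/measurable_EFinP.
  under eq_integral do rewrite /= ger0_norm//.
  by rewrite -dist// (le_lt_trans (probability_le1 _ _))// ltry.
have iy y : mu.-integrable `]-oo, y] (EFin \o g) by exact: integrableS ig.
have := FTC1Ny iy (open_integrable_locally openT ig).
rewrite (_ : (fun x => _) = real_cdf); last first.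
  by apply/funext => x; rewrite /Rintegral -dist.
apply: (@filterS _ _ (ae_filter_ringOfSetsType mu)) => x [dF F'].
by rewrite -F' derive1E; exact: derivableP.
Qed.

(** The exceptional [v] are those that [Q] sends to points where [F' = g] fails
    or where [g] vanishes; the law of [X] charges neither set, so by the inverse
    transform they form a Lebesgue-null set. *)
Lemma ae_quantile_density : {ae mu, forall v, 0 < v < 1 ->
  0 < g (quantile X v) /\ quantile_density X v = (g (quantile X v))^-1}.
Proof.
have [mg g0 dist] := Xg.
have [M [mM M0 subM]] := ae_is_derive_real_cdf.
pose Z := g @^-1` [set 0].
have mZ : measurable Z by rewrite -[Z]setTI; exact: mg.
have PM : distribution P X M = 0%E.
  rewrite dist// null_set_integral//; apply/measurable_EFinP.
  exact: measurable_funS mg.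
have PZ : distribution P X Z = 0%E.
  by rewrite dist// integral0_eq// => x ->.
exists (`]0, 1[ `&` quantile X @^-1` (M `|` Z)); split.
- by apply: measurable_quantile => //; exact: measurableU.
- rewrite quantile_transform; last exact: measurableU.
  by apply: null_set_setU.
move=> v /= Nv; apply: contrapT => NN; apply: Nv => v01.
have NM : ~ M (quantile X v) by move=> Mv; apply: NN; split; [|left].
have gv : 0 < g (quantile X v).
  rewrite lt_neqAle g0 andbT; apply/eqP => gE.
  by apply: NN; split; [|right].
split=> //.
have dF : is_derive (quantile X v) 1 real_cdf (g (quantile X v)).
  by apply: contrapT => /subM.
rewrite /quantile_density derive1E.
suff /@derive_val : is_derive v 1 (quantile X) (g (quantile X v))^-1 by [].
apply: is_derive_right_inverse dF gv; first exact: real_cdf_nondecreasing.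
near=> w; apply: real_cdf_quantile; apply/andP; split; near: w.
  by apply: lt_nbhsr; case/andP: v01.
by apply: lt_nbhsl; case/andP: v01.
Unshelve. all: end_near. Qed.

End with_density.
End quantile_theory.

(** * Comparison of the entropies *)

Theorem theorem2p2 (R : realType) (dX dY : measure_display)
    (TX : measurableType dX) (TY : measurableType dY)
    (PX : probability TX R) (PY : probability TY R)
    (X : {RV PX >-> R}) (Y : {RV PY >-> R}) (gX gY : R -> R) (eta : R)
    (X_ge0 : nonnegative_rv X) (Y_ge0 : nonnegative_rv Y)
    (X_density : is_density X gX) (Y_density : is_density Y gY)
    (eta_gt0 : 0 < eta)
    (X_finite : qfgcpe_finite eta X) (Y_finite : qfgcpe_finite eta Y) :
  hq_le X Y gX gY \/ rhq_le Y X gY gX -> qfgcpe_le X Y eta.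
Proof.
move=> orders.
have gYX v : 0 < v < 1 -> gY (quantile Y v) <= gX (quantile X v).
  move=> v01; have /andP[v0 v1] := v01.
  case: orders => /(_ v v01).
    by rewrite /hazard_quantile ler_pM2r// invr_gt0 subr_gt0.
  by rewrite /rev_hazard_quantile ler_pM2r// invr_gt0.
have [N [mN N0 subN]] : {ae lebesgue_measure, forall v : R, 0 < v < 1 ->
    quantile_density X v <= quantile_density Y v}.
  move: (ae_quantile_density X_density) (ae_quantile_density Y_density).
  apply: (@filterS2 _ _ (ae_filter_ringOfSetsType lebesgue_measure)).
  move=> v HX HY v01.
  have [gX0 ->] := HX v01; have [gY0 ->] := HY v01.
  by rewrite lef_pV2 ?posrE// gYX.
rewrite /qfgcpe_le /qfgcpe; apply: ler_wpM2l.
  rewrite invr_ge0; apply: Rintegral_ge0 => t _.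
  by apply: mulr_ge0; [exact: powR_ge0|exact: expR_ge0].
have mI : measurable (`]0, 1[ : set (measurableTypeR R)) by [].
have mD : measurable ((`]0, 1[ : set (measurableTypeR R)) `\` N).
  exact: measurableD.
rewrite /Rintegral (negligible_integral mN mI X_finite N0).
rewrite (negligible_integral mN mI Y_finite N0).
have sub_D : `]0, 1[ `\` N `<=` `]0, 1[ by exact: subDsetl.
apply: (le_Rintegral mD (integrableS mI mD sub_D X_finite)
  (integrableS mI mD sub_D Y_finite)) => v [/= v01 Nv].
apply: ler_wpM2l.
  apply: mulr_ge0; last exact: powR_ge0.
  by move: v01; rewrite in_itv/= => /andP[/ltW].
by apply: contrapT => qvN; apply: Nv; apply: subN => /= /(_ v01).
Qed.
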